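(* Let $\alpha\in(0,1]$ (so $\alpha\neq 0$), $\beta\in(0,\infty)$, $\nu\in(0,2]$, $\eta\in(0,\infty)$. The critical subset $S_1=\{\boldsymbol z\in\mathcal M_4 : \operatorname{rank} d\Phi(\boldsymbol z)=1\}$ of the integral map $\Phi=(\mathcal F_2,\mathcal E):\mathcal M_4\to\mathbb R^2$ equals $$S_1^\alpha=\Big\{(\boldsymbol\omega,\boldsymbol\gamma)\ :\ \boldsymbol\omega=\omega_0(\vartheta)\,\frac{\boldsymbol\gamma\times(\boldsymbol e_3\times\boldsymbol\gamma)}{|\boldsymbol e_3\times\boldsymbol\gamma|},\ \ \boldsymbol\gamma=\boldsymbol\gamma(\vartheta,\varphi)\Big\},$$ where $\boldsymbol\gamma(\vartheta,\varphi)=(\sin\vartheta\sin\varphi,\ \sin\vartheta\cos\varphi,\ \cos\vartheta)$, $\varphi\in[0,2\pi)$, $\omega_0(\vartheta)$ is either of the two real square roots of $$\omega_0^2=\frac{-\eta\sin^2\vartheta\,\big((1-\beta^2)\cos\vartheta+\alpha Z(\vartheta)\big)}{\cos\vartheta\, Z(\vartheta)\,\big(\eta(Z(\vartheta)+\alpha\cos\vartheta)^2+\cos^2\vartheta+\nu\sin^2\vartheta\big)},\qquad Z(\vartheta)=\sqrt{\beta^2\sin^2\vartheta+\cos^2\vartheta},$$ and $\vartheta$ ranges over those values in $(0,\pi)\setminus\{\pi/2\}$ for which the right-hand side of this expression for $\omega_0^2$ is nonnegative.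
   Context: Setting: a dynamically symmetric ellipsoid of revolution rolls on a horizontal plane without slipping and without spinning about the vertical. Units are dimensionless: mass unit is the body's mass $m$, length unit is the semiaxis $b_3$ along the symmetry axis, time unit is $\sqrt{b_3/\mathrm g}$. Parameters: $\alpha=a/b_3\in[0,1]$ (displacement of the center of mass from the geometric center along the symmetry axis), $\beta=b_1/b_3\in(0,\infty)$ ($b_1$ the equatorial semiaxis), $\nu=i_3/i_1\in(0,2]$, $\eta=mb_3^2/i_1\in(0,\infty)$, where $\mathbf I=\operatorname{diag}(i_1,i_1,i_3)$ is the principal central inertia tensor; in dimensionless units $\mathbf I=\operatorname{diag}(1/\eta,1/\eta,\nu/\eta)$. All vectors are written in a body-fixed frame with origin at the center of mass and third basis vector $\boldsymbol e_3$ along the symmetry axis. $\boldsymbol\omega\in\mathbb R^3$ is the angular velocity and $\boldsymbol\gamma\in\mathbb R^3$ the upward vertical unit vector. The vector from the center of mass to the contact point is $$\boldsymbol r(\boldsymbol\gamma)=-\frac{(\beta^2\gamma_1,\beta^2\gamma_2,\gamma_3)}{\sqrt{\beta^2(\gamma_1^2+\gamma_2^2)+\gamma_3^2}}-\alpha\boldsymbol e_3 ,$$ and $\mathbf J=\mathbf I+|\boldsymbol r|^2\mathbf E_3-\boldsymbol r\otimes\boldsymbol r$, where $\mathbf E_3$ is the $3\times 3$ identity matrix. Define on $\{\boldsymbol z=(\boldsymbol\omega,\boldsymbol\gamma)\}$ the functions $\mathcal F_0=(\boldsymbol\gamma,\boldsymbol\gamma)$, $\mathcal F_1=(\boldsymbol\omega,\boldsymbol\gamma)$,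 $\mathcal F_2=J(\gamma_3)\,\omega_3$ with $J(\gamma_3)=\sqrt{\tfrac1\eta\big(\gamma_3^2+\nu(1-\gamma_3^2)\big)+(\boldsymbol r,\boldsymbol\gamma)^2}$, and the energy $\mathcal E=\tfrac12(\mathbf J\boldsymbol\omega,\boldsymbol\omega)-(\boldsymbol r,\boldsymbol\gamma)$. These are first integrals of the equations of motion on $\mathcal F_1=0$. The four-dimensional phase space is $\mathcal M_4=\{\boldsymbol z=(\boldsymbol\omega,\boldsymbol\gamma): \mathcal F_0=1,\ \mathcal F_1=0\}$, and the integral map is $\Phi:\mathcal M_4\to\mathbb R^2$, $\Phi(\boldsymbol z)=(\mathcal F_2(\boldsymbol z),\mathcal E(\boldsymbol z))$; $d\Phi$ is its differential on $\mathcal M_4$. *)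

(* Defs.v *)
From HB Require Import structures.
From mathcomp Require Import all_boot all_order all_algebra.
From mathcomp Require Import all_classical all_reals all_analysis.

Set Implicit Arguments.
Unset Strict Implicit.
Unset Printing Implicit Defensive.

Import Order.TTheory GRing.Theory Num.Theory.
Import numFieldNormedType.Exports.

Local Open Scope classical_set_scope.
Local Open Scope ring_scope.

Definition vec2 (R : realType) (a b : R) : 'rV[R]_2 :=
  \row_(i < 2) [:: a; b]`_i.

Definition vec3 (R : realType) (a b c : R) : 'rV[R]_3 :=
  \row_(i < 3) [:: a; b; c]`_i.

Definition e3 (R : realType) : 'rV[R]_3 := vec3 0 0 1.

Definition dot (R : realType) (u v : 'rV[R]_3) : R := (u *m v^T) 0 0.

(* Euclidean norm: the library norm of a matrix is the sup norm. *)
Definition enorm (R : realType) (u : 'rV[R]_3) : R := Num.sqrt (dot u u).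

Definition cross (R : realType) (u v : 'rV[R]_3) : 'rV[R]_3 :=
  vec3 (u 0 1 * v 0 2 - u 0 2 * v 0 1)
       (u 0 2 * v 0 0 - u 0 0 * v 0 2)
       (u 0 0 * v 0 1 - u 0 1 * v 0 0).

(* A point z = (omega, gamma) of R^6 is the row vector [row_mx omega gamma]. *)
Definition omega_of (R : realType) (z : 'rV[R]_(3 + 3)) : 'rV[R]_3 := lsubmx z.
Definition gamma_of (R : realType) (z : 'rV[R]_(3 + 3)) : 'rV[R]_3 := rsubmx z.

Definition contact (R : realType) (alpha beta : R) (g : 'rV[R]_3) : 'rV[R]_3 :=
  - ((Num.sqrt (beta ^+ 2 * (g 0 0 ^+ 2 + g 0 1 ^+ 2) + g 0 2 ^+ 2))^-1 *:
       vec3 (beta ^+ 2 * g 0 0) (beta ^+ 2 * g 0 1) (g 0 2))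
  - alpha *: e3 R.

Definition inertia (R : realType) (nu eta : R) : 'M[R]_3 :=
  diag_mx (vec3 (1 / eta) (1 / eta) (nu / eta)).

Definition Jtensor (R : realType) (alpha beta nu eta : R) (g : 'rV[R]_3) :
    'M[R]_3 :=
  let r := contact alpha beta g in
  inertia nu eta + (enorm r ^+ 2)%:M - r^T *m r.

(* On the unit sphere (r, gamma) depends on gamma_3 only, and so does Jfun. *)
Definition Jfun (R : realType) (alpha beta nu eta : R) (g : 'rV[R]_3) : R :=
  Num.sqrt (1 / eta * (g 0 2 ^+ 2 + nu * (1 - g 0 2 ^+ 2))
            + dot (contact alpha beta g) g ^+ 2).

Definition F0 (R : realType) (z : 'rV[R]_(3 + 3)) : R :=
  dot (gamma_of z) (gamma_of z).

Definition F1 (R : realType) (z : 'rV[R]_(3 + 3)) : R :=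
  dot (omega_of z) (gamma_of z).

Definition F2 (R : realType) (alpha beta nu eta : R) (z : 'rV[R]_(3 + 3)) : R :=
  Jfun alpha beta nu eta (gamma_of z) * omega_of z 0 2.

(* The operator J acts on the column vector omega^T. *)
Definition energy (R : realType) (alpha beta nu eta : R)
    (z : 'rV[R]_(3 + 3)) : R :=
  1 / 2 * dot (Jtensor alpha beta nu eta (gamma_of z) *m (omega_of z)^T)^T
              (omega_of z)
  - dot (contact alpha beta (gamma_of z)) (gamma_of z).

Definition M4 (R : realType) : set 'rV[R]_(3 + 3) :=
  [set z | F0 z = 1 /\ F1 z = 0].

Definition constraints (R : realType) (z : 'rV[R]_(3 + 3)) : 'rV[R]_2 :=
  vec2 (F0 z) (F1 z).

Definition Phi (R : realType) (alpha beta nu eta : R) (z : 'rV[R]_(3 + 3)) :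
    'rV[R]_2 :=
  vec2 (F2 alpha beta nu eta z) (energy alpha beta nu eta z).

(* (1, 0) is a regular value of (F0, F1), so the tangent space of M4 at z is
   the kernel of d(F0, F1)(z). Differentials act on row vectors by right
   multiplication by the Jacobian matrix, hence this kernel is the row space
   of the matrix below. *)
Definition tangentM4 (R : realType) (z : 'rV[R]_(3 + 3)) : 'M[R]_(3 + 3) :=
  kermx (jacobian (@constraints R) z).

(* Rank of the restriction of the differential of Phi to the tangent space of
   M4 at z, i.e. the dimension of the image of that space. *)
Definition rank_dPhi (R : realType) (alpha beta nu eta : R)
    (z : 'rV[R]_(3 + 3)) : nat :=
  \rank (tangentM4 z *m jacobian (Phi alpha beta nu eta) z).

Definition S1 (R : realType) (alpha beta nu eta : R) : set 'rV[R]_(3 + 3) :=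
  [set z | M4 z /\ rank_dPhi alpha beta nu eta z = 1%N].

Definition gamma_angles (R : realType) (theta phi : R) : 'rV[R]_3 :=
  vec3 (sin theta * sin phi) (sin theta * cos phi) (cos theta).

Definition Zfun (R : realType) (beta theta : R) : R :=
  Num.sqrt (beta ^+ 2 * sin theta ^+ 2 + cos theta ^+ 2).

Definition omega0_sq (R : realType) (alpha beta nu eta theta : R) : R :=
  let Z := Zfun beta theta in
  (- eta * sin theta ^+ 2 * ((1 - beta ^+ 2) * cos theta + alpha * Z))
  / (cos theta * Z *
     (eta * (Z + alpha * cos theta) ^+ 2 + cos theta ^+ 2
      + nu * sin theta ^+ 2)).

Definition S1alpha (R : realType) (alpha beta nu eta : R) :
    set 'rV[R]_(3 + 3) :=
  [set z | exists theta phi omega0 : R,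
    [/\ 0 < theta < pi /\ theta <> pi / 2,
        0 <= phi < 2 * pi,
        0 <= omega0_sq alpha beta nu eta theta
          /\ omega0 ^+ 2 = omega0_sq alpha beta nu eta theta,
        gamma_of z = gamma_angles theta phi
      & omega_of z =
          omega0 *: ((enorm (cross (e3 R) (gamma_of z)))^-1 *:
            cross (gamma_of z) (cross (e3 R) (gamma_of z)))]].

(* Main.v *)
Require Import Defs.
From mathcomp Require Import all_boot all_order all_algebra.
From mathcomp Require Import ring lra.
From mathcomp Require Import all_classical all_reals all_analysis.
Import Order.TTheory GRing.Theory Num.Theory.
Import numFieldNormedType.Exports.
Local Open Scope ring_scope.

(** Let [k = gamma x (e3 x gamma) = e3 - gamma_3 gamma] and
    [n = e3 x gamma], two orthogonal vectors of squared length
    [sin^2 theta] that span the plane orthogonal to [gamma] when [gamma] is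
    not a pole.  Writing [omega = p k + q n], so that
    [omega_3 = p sin^2 theta], the contact vector [r] lies in the plane of
    [gamma] and [k], and a computation gives on M4

      [E = F2^2 / (2 sin^2 theta)
           + q^2 sin^2 theta (1 / eta + |r|^2) / 2 + Z + alpha cos theta].

    Since [J > 0], one may use [theta, phi, F2, q] as coordinates.  As [F2] is
    one of them, the rank of the differential is at least 1, and it is 1
    exactly when the derivatives of [E] in [q] and in [theta] vanish.  The
    first condition is [q = 0].  With [F2 = J p sin^2 theta], the second one
    reads

      [p^2 J^2 cos theta + (1 - beta^2) cos theta / Z + alpha = 0].

    On the equator it says [alpha = 0], which is excluded; elsewhere it
    can be solved for [omega_0^2 = p^2 sin^2 theta], and the solution is the
    stated formula ([omega0_sqP]).  At the poles the coordinates fail: there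
    the rank is 0 if [omega = 0] and 2 otherwise ([rank_dPhi_pole]).

    The coordinates are never introduced.  The differentials of [F2] and
    [E] are computed in the ambient space, and [dE_meridional] is the identity
    [dE = (F2 / sin^2 theta) dF2 + (dE / dcos theta) dgamma_3], restricted to
    tangent vectors at the points with [q = 0].  The coordinate vectors are
    replaced by the explicit tangent vectors [(k, 0)], [(n, 0)] and
    [(- p sin^2 theta gamma, k)].  The outcome is [rank_dPhi1P]. *)

(** * Vectors of the three-dimensional space *)

Section Coordinates.
Context {R : realType}.
Implicit Types u v g : 'rV[R]_3.

Lemma sum3E (F : 'I_3 -> R) : \sum_i F i = F 0 + F 1 + F 2.
Proof.
rewrite !big_ord_recr big_ord0 /= add0r.
by congr (F _ + F _ + F _); apply: val_inj.
Qed.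

Lemma dotE u v : dot u v = u 0 0 * v 0 0 + u 0 1 * v 0 1 + u 0 2 * v 0 2.
Proof. by rewrite /dot mxE sum3E !mxE. Qed.

Lemma dotC u v : dot u v = dot v u.
Proof. by rewrite !dotE; ring. Qed.

Lemma dotZl a u v : dot (a *: u) v = a * dot u v.
Proof. by rewrite !dotE !mxE; ring. Qed.

Lemma vec3E (a b c : R) :
  (vec3 a b c 0 0 = a) * (vec3 a b c 0 1 = b) * (vec3 a b c 0 2 = c).
Proof. by rewrite !mxE. Qed.

Lemma vec3_eta u : u = vec3 (u 0 0) (u 0 1) (u 0 2).
Proof.
apply/rowP => -[[|[|[|//]]] i]; rewrite mxE /=; congr (u _ _); exact: val_inj.
Qed.

Lemma row3P u v : u 0 0 = v 0 0 -> u 0 1 = v 0 1 -> u 0 2 = v 0 2 -> u = v.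
Proof. by rewrite (vec3_eta u) (vec3_eta v) !vec3E => -> -> ->. Qed.

Lemma vec2E (a b : R) : (vec2 a b 0 0 = a) * (vec2 a b 0 1 = b).
Proof. by rewrite !mxE. Qed.

Lemma row_mx_omega u v : omega_of (row_mx u v) = u.
Proof. exact: row_mxKl. Qed.

Lemma row_mx_gamma u v : gamma_of (row_mx u v) = v.
Proof. exact: row_mxKr. Qed.

Lemma cross_cross_e3 g : dot g g = 1 ->
  cross g (cross (e3 R) g) = e3 R - g 0 2 *: g.
Proof.
move=> gg; have h : g 0 0 ^+ 2 + g 0 1 ^+ 2 = 1 - g 0 2 ^+ 2.
  by rewrite -gg dotE; ring.
apply: row3P; rewrite /cross /e3 !(mxE, vec3E) /=; [ring|ring|].
by rewrite -[LHS]/(_ - _); transitivity (g 0 0 ^+ 2 + g 0 1 ^+ 2);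
  [ring|rewrite h; ring].
Qed.

Lemma enorm_cross_e3 g : dot g g = 1 ->
  enorm (cross (e3 R) g) = Num.sqrt (1 - g 0 2 ^+ 2).
Proof.
by move=> gg; rewrite /enorm -gg !dotE /cross /e3 !vec3E; congr Num.sqrt; ring.
Qed.

(** The angle is measured from the second axis, as in [gamma_angles]. *)
Lemma polar_angle (x y : R) : x ^+ 2 + y ^+ 2 = 1 ->
  exists2 phi, 0 <= phi < 2 * pi & x = sin phi /\ y = cos phi.
Proof.
move=> h; have hy : -1 <= y <= 1.
  by have := sqr_ge0 x; have := sqr_ge0 y; move=> ? ?; apply/andP; split; nra.
have ys : 1 - y ^+ 2 = x ^+ 2 by rewrite -h addrK.
have cy : cos (acos y) = y by apply: acosK; rewrite in_itv.
have pi0 := pi_gt0 R.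
have a0 := acos_ge0 hy; have a1 := acos_lepi hy.
have [x0|x0] := leP 0 x.
  exists (acos y); first by rewrite a0 /=; lra.
  by rewrite sin_acos // ys sqrtr_sqr ger0_norm.
exists (2 * pi - acos y).
  have y1 : y < 1 by nra.
  have : 0 < acos y by apply: acos_gt0; rewrite y1; case/andP: hy => ->.
  by lra.
rewrite mulr_natl [_ - acos y]addrC sinD2pi cosD2pi sinN cosN cy.
by rewrite sin_acos // ys sqrtr_sqr ltr0_norm // opprK.
Qed.

End Coordinates.

(** * Differential calculus of scalar functions *)

(** A plain proposition in place of the class [is_diff]: [apply] then leaves
    the differentials of subexpressions as goals, and instance resolution
    cannot replace them by pointwise expressions such as [(0 : V -> R) v]. *)
Definition has_diff {R : realType} {V W : normedModType R} (x : V)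
    (f df : V -> W) : Prop :=
  differentiable f x /\ 'd f x = df :> (V -> W).

Lemma has_diffP {R : realType} {V W : normedModType R} (x : V) (f df : V -> W) :
  has_diff x f df <-> is_diff x f df.
Proof. by split=> [[? ?]|[? ?]]; [apply: DiffDef|split]. Qed.

Lemma has_diff_eq {R : realType} {V W : normedModType R} {x : V}
    {f df dg : V -> W} :
  has_diff x f df -> df = dg -> has_diff x f dg.
Proof. by move=> h <-. Qed.

Section ScalarDifferentials.
Context {R : realType} {V : normedModType R}.
Implicit Types (f g df dg : V -> R) (x : V).

Lemma has_diff_add f g df dg x : has_diff x f df -> has_diff x g dg ->
  has_diff x (fun y => f y + g y) (fun v => df v + dg v).
Proof.
by move=> /has_diffP ? /has_diffP ?; apply/has_diffP; exact: is_diffD.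
Qed.

Lemma has_diff_sub f g df dg x : has_diff x f df -> has_diff x g dg ->
  has_diff x (fun y => f y - g y) (fun v => df v - dg v).
Proof.
by move=> /has_diffP ? /has_diffP ?; apply/has_diffP; exact: is_diffB.
Qed.

Lemma has_diff_mul f g df dg x : has_diff x f df -> has_diff x g dg ->
  has_diff x (fun y => f y * g y) (fun v => f x * dg v + g x * df v).
Proof.
by move=> /has_diffP ? /has_diffP ?; apply/has_diffP; exact: is_diffM.
Qed.

Lemma has_diff_sqr f df x : has_diff x f df ->
  has_diff x (fun y => f y ^+ 2) (fun v => 2 * f x * df v).
Proof.
move=> h; apply: (has_diff_eq (has_diff_mul f f df df x h h)).
by apply/funext => v; ring.
Qed.

Lemma has_diff_const (a : R) x : has_diff x (fun=> a) (fun=> 0 : R).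
Proof. apply/has_diffP; exact: is_diff_cst. Qed.

Lemma has_diff_inv f df x : f x != 0 -> has_diff x f df ->
  has_diff x (fun y => (f y)^-1) (fun v => - df v / f x ^+ 2).
Proof.
move=> fx0 [hf dfE]; split; first exact: differentiableV.
rewrite diffV //; apply/funext => v /=; rewrite dfE.
by rewrite mulNr scaleNr mulrC.
Qed.

Lemma has_diff_sqrt f df x : 0 < f x -> has_diff x f df ->
  has_diff x (fun y => Num.sqrt (f y)) (fun v => df v / (2 * Num.sqrt (f x))).
Proof.
move=> fx0 /has_diffP h; have [ds vs] := is_derive1_sqrt fx0.
have hs : is_diff (f x) Num.sqrt (fun t => t / (2 * Num.sqrt (f x))).
  have ds' := (derivable1_diffP _ _).1 ds.
  by apply: DiffDef => //; rewrite diff1E // derive1E vs.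
apply/has_diffP; exact: (is_diff_comp (f := f) (g := Num.sqrt)).
Qed.

End ScalarDifferentials.

Lemma has_diff_coord (R : realType) n (j : 'I_n) (z : 'rV[R]_n) :
  has_diff z (fun y : 'rV[R]_n => y 0 j : R) (fun v => v 0 j).
Proof.
have @f : {linear 'rV[R]_n -> R}.
  by exists (fun y : 'rV[R]_n => y 0 j); do 2![eexists]; do ?[constructor];
     rewrite ?mxE// => ? *; rewrite ?mxE//; move=> ?; rewrite !mxE.
split; first exact: differentiable_coord.
exact/(diff_lin (f := f))/coord_continuous.
Qed.

(** Reduces the Jacobian matrices of the constraints and of the integral map
    to the differentials of their two scalar components. *)
Lemma mul_jacobian_vec2 {R : realType} {n} {f g df dg : 'rV[R]_n -> R}
    (z v : 'rV[R]_n) : has_diff z f df -> has_diff z g dg ->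
  v *m jacobian (fun y => vec2 (f y) (g y)) z = vec2 (df v) (dg v).
Proof.
move=> hf hg; rewrite /jacobian mul_rV_lin1 /=.
have e (a b : R) : vec2 a b = a *: vec2 1 0 + b *: vec2 0 1.
  by apply/rowP => -[[|[|//]] i]; rewrite !mxE /=; ring.
have Zl (h dh : 'rV[R]_n -> R) (u : 'rV[R]_2) : has_diff z h dh ->
    has_diff z (fun y => h y *: u) (fun y => dh y *: u).
  move=> [hh dhE]; split; first exact: differentiableZl.
  by rewrite diffZl // dhE.
have H : has_diff z (fun y => vec2 (f y) (g y)) (fun y => vec2 (df y) (dg y)).
  under eq_fun do rewrite e.
  rewrite (_ : (fun y => vec2 (df y) _) =
    (fun y => df y *: vec2 1 0 + dg y *: vec2 0 1)); last first.
    by apply/funext => y; rewrite e.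
  by apply/has_diffP; apply: is_diffD; apply/has_diffP/Zl.
by rewrite H.2.
Qed.

(** * Matrices of rank one *)

Section RankOne.
Context {F : fieldType}.

Lemma rank1_proportional {m n} {M : 'M[F]_(m, n)} {u v : 'rV[F]_n} :
  \rank M = 1%N -> (u <= M)%MS -> (v <= M)%MS -> u != 0 ->
  exists a, forall j, v 0 j = a * u 0 j.
Proof.
move=> rM uM vM u0; suff /sub_rVP[a ->] : (v <= u)%MS.
  by exists a => j; rewrite mxE.
by apply: submx_trans vM _; rewrite -(mxrank_leqif_sup uM) rM rank_rV u0.
Qed.

Lemma rank_mulmx_eq1 {m n p} {K : 'M[F]_(m, n)} {L : 'M[F]_(n, p)}
    (u : 'rV[F]_p) (v : 'rV[F]_n) :
  (forall w : 'rV_n, (w <= K)%MS -> (w *m L <= u)%MS) ->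
  (v <= K)%MS -> v *m L != 0 -> \rank (K *m L) = 1%N.
Proof.
move=> Ku vK vL0; apply/eqP; rewrite eqn_leq; apply/andP; split.
  have KLu : (K *m L <= u)%MS.
    by apply/row_subP => i; rewrite row_mul Ku ?row_sub.
  by rewrite (leq_trans (mxrankS KLu)) // rank_rV leq_b1.
by have := mxrankS (submxMr L vK); rewrite rank_rV vL0.
Qed.

End RankOne.

(** * The integrals in coordinates *)

Section IntegralMap.
Context {R : realType} (alpha beta nu eta : R).
Implicit Types z v : 'rV[R]_(3 + 3).

Local Notation w0 z := (omega_of z 0 0).
Local Notation w1 z := (omega_of z 0 1).
Local Notation w2 z := (omega_of z 0 2).
Local Notation g0 z := (gamma_of z 0 0).
Local Notation g1 z := (gamma_of z 0 1).
Local Notation g2 z := (gamma_of z 0 2).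
Local Notation F2 := (F2 alpha beta nu eta).
Local Notation energy := (energy alpha beta nu eta).
Local Notation Phi := (Phi alpha beta nu eta).

(** [Zof] extends the function Z of the angle to all of phase space.  The
    contact vector is [- (Aof g0, Aof g1, Dof)], and [Jsq] is [J^2] with
    [(r, gamma)] replaced by its value [- (Zof + alpha g2)]. *)
Definition Zsq z := beta ^+ 2 * (g0 z ^+ 2 + g1 z ^+ 2) + g2 z ^+ 2.
Definition Zof z := Num.sqrt (Zsq z).
Definition Aof z := beta ^+ 2 / Zof z.
Definition Dof z := g2 z / Zof z + alpha.
Definition Jsq z :=
  1 / eta * (g2 z ^+ 2 + nu * (1 - g2 z ^+ 2)) + (Zof z + alpha * g2 z) ^+ 2.

Lemma Zsq_ge0 z : 0 <= Zsq z.
Proof.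
by rewrite /Zsq; do ?[exact: sqr_ge0|apply: addr_ge0|apply: mulr_ge0].
Qed.

Lemma contactE z : contact alpha beta (gamma_of z) =
  vec3 (- (Aof z * g0 z)) (- (Aof z * g1 z)) (- Dof z).
Proof.
apply: row3P; rewrite /contact /e3 /Aof /Dof /Zof /Zsq !(mxE, vec3E) /=.
- ring.
- ring.
- ring.
Qed.

Lemma Zof_sq z : Zof z ^+ 2 = Zsq z.
Proof. exact/sqr_sqrtr/Zsq_ge0. Qed.

Lemma contact_gammaE z :
  dot (contact alpha beta (gamma_of z)) (gamma_of z) = - (Zof z + alpha * g2 z).
Proof.
rewrite contactE dotE !vec3E /Aof /Dof.
(* If Zof z = 0, the quotients by Zof z are 0, as the inverse of 0 is 0. *)
have [->|Z0] := eqVneq (Zof z) 0; first by rewrite invr0; ring.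
have e : Zof z = Zsq z / Zof z by rewrite -Zof_sq; field.
by rewrite [in RHS]e /Zsq; field.
Qed.

Lemma F2E z : F2 z = Num.sqrt (Jsq z) * w2 z.
Proof. by rewrite /F2 /Jfun contact_gammaE sqrrN. Qed.

(** [r_sq] is [|r|^2] and [r_omega] is [- (r, omega)]. *)
Definition r_sq z := Aof z ^+ 2 * (g0 z ^+ 2 + g1 z ^+ 2) + Dof z ^+ 2.
Definition r_omega z := Aof z * (g0 z * w0 z + g1 z * w1 z) + Dof z * w2 z.

Lemma energyE z : energy z =
  1 / 2 * ((w0 z ^+ 2 + w1 z ^+ 2 + nu * w2 z ^+ 2) / eta
           + r_sq z * (w0 z ^+ 2 + w1 z ^+ 2 + w2 z ^+ 2) - r_omega z ^+ 2)
  + (Zof z + alpha * g2 z).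
Proof.
rewrite /energy contact_gammaE opprK; congr (_ * _ + _).
rewrite dotE !mxE !sum3E /Jtensor /inertia !(mxE, vec3E, eqxx) /=.
rewrite /enorm sqr_sqrtr; last by rewrite dotE -!expr2 !addr_ge0 ?sqr_ge0.
rewrite dotE contactE /r_sq /r_omega !big_ord_recr !big_ord0 /= !mxE /=.
rewrite !mulr1n !mulr0n; ring.
Qed.

(** * Differentials of the integrals *)

Lemma has_diff_omega i z :
  has_diff z (fun y => omega_of y 0 i : R) (fun v => omega_of v 0 i).
Proof.
have e : (fun y : 'rV[R]_(3 + 3) => omega_of y 0 i) = fun y => y 0 (lshift 3 i).
  by apply/funext => y; rewrite mxE.
rewrite e; exact: has_diff_coord.
Qed.

Lemma has_diff_gamma i z :
  has_diff z (fun y => gamma_of y 0 i : R) (fun v => gamma_of v 0 i).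
Proof.
have e : (fun y : 'rV[R]_(3 + 3) => gamma_of y 0 i) = fun y => y 0 (rshift 3 i).
  by apply/funext => y; rewrite mxE.
rewrite e; exact: has_diff_coord.
Qed.

Ltac isdiff := repeat first
  [ eassumption | apply: has_diff_omega | apply: has_diff_gamma
  | apply: has_diff_const | apply: has_diff_sqr | apply: has_diff_sub
  | apply: has_diff_add | apply: has_diff_mul ].

Lemma has_diff_F0 z : has_diff z (@F0 R)
  (fun v => 2 * dot (gamma_of z) (gamma_of v)).
Proof.
rewrite /F0; under eq_fun do rewrite dotE.
apply: has_diff_eq; first by isdiff.
by apply/funext => v; rewrite dotE; ring.
Qed.

Lemma has_diff_F1 z : has_diff z (@F1 R)
  (fun v => dot (omega_of v) (gamma_of z) + dot (omega_of z) (gamma_of v)).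
Proof.
rewrite /F1; under eq_fun do rewrite dotE.
apply: has_diff_eq; first by isdiff.
by apply/funext => v; rewrite !dotE; ring.
Qed.

(** The differentials at [z] applied to [v]; the sums over the first two
    components are kept together because on tangent vectors they can be
    expressed by third components only. *)
Definition dZ z v :=
  (beta ^+ 2 * (g0 z * g0 v + g1 z * g1 v) + g2 z * g2 v) / Zof z.
Definition dA z v := - (beta ^+ 2 * dZ z v) / Zof z ^+ 2.
Definition dD z v := g2 v / Zof z - g2 z * dZ z v / Zof z ^+ 2.
Definition dJsq z v := 2 / eta * (1 - nu) * (g2 z * g2 v)
  + 2 * (Zof z + alpha * g2 z) * (dZ z v + alpha * g2 v).
Definition dr_sq z v :=
  2 * (Aof z * dA z v * (g0 z ^+ 2 + g1 z ^+ 2)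
       + Aof z ^+ 2 * (g0 z * g0 v + g1 z * g1 v) + Dof z * dD z v).
Definition dr_omega z v :=
  dA z v * (g0 z * w0 z + g1 z * w1 z)
  + Aof z * ((g0 z * w0 v + g1 z * w1 v) + (w0 z * g0 v + w1 z * g1 v))
  + dD z v * w2 z + Dof z * w2 v.
Definition dF2 z v :=
  Num.sqrt (Jsq z) * w2 v + w2 z * (dJsq z v / (2 * Num.sqrt (Jsq z))).
Definition dE z v :=
  (w0 z * w0 v + w1 z * w1 v + nu * (w2 z * w2 v)) / eta
  + dr_sq z v / 2 * (w0 z ^+ 2 + w1 z ^+ 2 + w2 z ^+ 2)
  + r_sq z * (w0 z * w0 v + w1 z * w1 v + w2 z * w2 v)
  - r_omega z * dr_omega z v + (dZ z v + alpha * g2 v).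

Lemma has_diff_Zof z : 0 < Zsq z -> has_diff z Zof (dZ z).
Proof.
move=> Z0; apply: has_diff_eq; first apply: (has_diff_sqrt Zsq _ z Z0).
  by rewrite /Zsq; isdiff.
apply/funext => v; rewrite /dZ -/(Zof z).
have : Zof z != 0 by rewrite gt_eqF // sqrtr_gt0.
by move=> ?; field.
Qed.

Lemma has_diff_Aof z : 0 < Zsq z -> has_diff z Aof (dA z).
Proof.
move=> Z0; have hZ := has_diff_Zof z Z0.
have Z1 : Zof z != 0 by rewrite gt_eqF // sqrtr_gt0.
have hV := has_diff_inv Zof _ z Z1 hZ.
apply: has_diff_eq; first by rewrite /Aof; isdiff.
by apply/funext => v; rewrite /dA; field.
Qed.

Lemma has_diff_Dof z : 0 < Zsq z -> has_diff z Dof (dD z).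
Proof.
move=> Z0; have hZ := has_diff_Zof z Z0.
have Z1 : Zof z != 0 by rewrite gt_eqF // sqrtr_gt0.
have hV := has_diff_inv Zof _ z Z1 hZ.
apply: has_diff_eq; first by rewrite /Dof; isdiff.
by apply/funext => v; rewrite /dD; field.
Qed.

Lemma has_diff_F2 z : 0 < Zsq z -> 0 < Jsq z -> has_diff z F2 (dF2 z).
Proof.
move=> Z0 Q0; have hZ := has_diff_Zof z Z0.
have hQ : has_diff z Jsq (dJsq z).
  apply: has_diff_eq; first by rewrite /Jsq; isdiff.
  by apply/funext => v; rewrite /dJsq; ring.
have hs := has_diff_sqrt Jsq _ z Q0 hQ.
by rewrite (funext F2E); isdiff.
Qed.

Lemma has_diff_energy z : 0 < Zsq z -> has_diff z energy (dE z).
Proof.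
move=> Z0; have hZ := has_diff_Zof z Z0.
have hA := has_diff_Aof z Z0; have hD := has_diff_Dof z Z0.
have hr : has_diff z r_sq (dr_sq z).
  apply: has_diff_eq; first by rewrite /r_sq; isdiff.
  by apply/funext => v; rewrite /dr_sq; ring.
have ho : has_diff z r_omega (dr_omega z).
  apply: has_diff_eq; first by rewrite /r_omega; isdiff.
  by apply/funext => v; rewrite /dr_omega; ring.
apply: has_diff_eq.
  by rewrite (funext energyE); isdiff.
by apply/funext => v; rewrite /dE; move: (eta^-1) => i; field.
Qed.

(** * The rank of the integral map *)

Hypotheses (hbeta : 0 < beta) (hnu : 0 < nu) (heta : 0 < eta).

Lemma tangentE z v : (v <= tangentM4 z)%MS <->
  dot (gamma_of z) (gamma_of v) = 0 /\
  dot (omega_of v) (gamma_of z) + dot (omega_of z) (gamma_of v) = 0.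
Proof.
have J := mul_jacobian_vec2 z v (has_diff_F0 z) (has_diff_F1 z).
have K : (v <= tangentM4 z)%MS <-> v *m jacobian (@constraints R) z = 0.
  by split=> /sub_kermxP.
rewrite K J; split=> [/rowP E|[-> ->]].
  have := E 0; have := E 1; rewrite !vec2E !mxE => -> /eqP.
  by rewrite mulf_eq0 pnatr_eq0 /= => /eqP.
by apply/rowP => -[[|[|//]] i]; rewrite !mxE /= ?mulr0.
Qed.

Section AtPoint.
Variable z : 'rV[R]_(3 + 3).
Hypothesis M4z : M4 z.

Let c := g2 z.
Let Z := Zof z.

Lemma gamma_sq : g0 z ^+ 2 + g1 z ^+ 2 = 1 - c ^+ 2.
Proof. by have [h _] := M4z; rewrite -h /F0 dotE /c; ring. Qed.

Lemma omega_gamma : w0 z * g0 z + w1 z * g1 z + w2 z * c = 0.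
Proof. by have [_ h] := M4z; rewrite -h /F1 dotE. Qed.

Lemma c_sq_le1 : c ^+ 2 <= 1.
Proof. by rewrite -subr_ge0 -gamma_sq addr_ge0 ?sqr_ge0. Qed.

Lemma ZsqE : Zsq z = beta ^+ 2 * (1 - c ^+ 2) + c ^+ 2.
Proof. by rewrite /Zsq gamma_sq. Qed.

(** A convex combination of [beta^2] and 1. *)
Lemma Zsq_gt0 : 0 < Zsq z.
Proof.
rewrite ZsqE; have b2 : 0 < beta ^+ 2 by rewrite exprn_gt0.
move: c_sq_le1 (sqr_ge0 c) b2; move: (beta ^+ 2) (c ^+ 2) => b t t1 t0 b0.
by have [t0'|t0'] := ltrP 0 t; nra.
Qed.

Lemma Z_gt0 : 0 < Z. Proof. by rewrite sqrtr_gt0 Zsq_gt0. Qed.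

Lemma Jsq_gt0 : 0 < Jsq z.
Proof.
rewrite ltr_wpDr ?sqr_ge0 // mulr_gt0 ?divr_gt0 //.
rewrite -/c; move: c_sq_le1 (sqr_ge0 c); move: (c ^+ 2) => t t1.
rewrite le_eqVlt => /predU1P[<-|t0]; first by rewrite subr0 mulr1 add0r.
by have := hnu; nra.
Qed.

Lemma mul_jacobian_Phi v : v *m jacobian Phi z = vec2 (dF2 z v) (dE z v).
Proof.
apply: mul_jacobian_vec2.
  exact: (has_diff_F2 _ Zsq_gt0 Jsq_gt0).
exact: (has_diff_energy _ Zsq_gt0).
Qed.

(** If [omega = p k], then [p J = F2 / sin^2 theta] is the derivative
    of the reduced energy [F2^2 / (2 sin^2 theta) + Z + alpha cos theta] in
    [F2], and the coefficient of [g2 v] is its derivative in [cos theta] at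
    constant [F2].  On a tangent vector every term of [dE] depends on [w2 v]
    and [g2 v] alone. *)
Lemma dE_meridional v p : c ^+ 2 != 1 ->
  omega_of z = p *: (e3 R - c *: gamma_of z) -> (v <= tangentM4 z)%MS ->
  dE z v = p * Num.sqrt (Jsq z) * dF2 z v
    + (p ^+ 2 * Jsq z * c + (1 - beta ^+ 2) * c / Z + alpha) * g2 v.
Proof.
move=> c1 om /tangentE []; rewrite !dotE => tg tw.
have N0 : 1 - c ^+ 2 != 0 by rewrite subr_eq0 eq_sym.
have e0 : w0 z = - (p * c * g0 z) by rewrite om /e3 !mxE /=; ring.
have e1 : w1 z = - (p * c * g1 z) by rewrite om /e3 !mxE /=; ring.
have e2 : w2 z = p * (1 - c ^+ 2) by rewrite om /e3 !mxE /= /c mxE; ring.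
have hU : g0 z * g0 v + g1 z * g1 v = - (c * g2 v).
  by apply/eqP; rewrite -addr_eq0 tg.
have hW : g0 z * w0 v + g1 z * w1 v = - (c * w2 v) - p * g2 v.
  apply/eqP; rewrite -subr_eq0 -tw e0 e1 e2 -/c; apply/eqP.
  have -> : p * (1 - c ^+ 2) * g2 v = p * g2 v + p * c * (- (c * g2 v)) by ring.
  by rewrite -hU; ring.
have hom : w0 z ^+ 2 + w1 z ^+ 2 + w2 z ^+ 2 = p ^+ 2 * (1 - c ^+ 2).
  rewrite e0 e1 e2.
  transitivity (p ^+ 2 * c ^+ 2 * (g0 z ^+ 2 + g1 z ^+ 2)
    + (p * (1 - c ^+ 2)) ^+ 2); first by ring.
  by rewrite gamma_sq; ring.
have hov : w0 z * w0 v + w1 z * w1 v = p * c ^+ 2 * w2 v + p ^+ 2 * c * g2 v.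
  transitivity (- (p * c) * (g0 z * w0 v + g1 z * w1 v)).
    by rewrite e0 e1; ring.
  by rewrite hW; ring.
have hrom : g0 z * w0 z + g1 z * w1 z = - (p * c * (1 - c ^+ 2)).
  by rewrite e0 e1 -gamma_sq; ring.
have hog : w0 z * g0 v + w1 z * g1 v = p * c ^+ 2 * g2 v.
  transitivity (- (p * c) * (g0 z * g0 v + g1 z * g1 v)).
    by rewrite e0 e1; ring.
  by rewrite hU; ring.
have hdF : p * Num.sqrt (Jsq z) * dF2 z v
    = p * (Jsq z * w2 v + p * (1 - c ^+ 2) * dJsq z v / 2).
  have Q0 : Num.sqrt (Jsq z) != 0 by rewrite gt_eqF // sqrtr_gt0 Jsq_gt0.
  transitivity (p * (Num.sqrt (Jsq z) ^+ 2 * w2 v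
      + p * (1 - c ^+ 2) * dJsq z v / 2)); first by rewrite /dF2 e2; field.
  by rewrite sqr_sqrtr // ltW // Jsq_gt0.
have Z0 : Z != 0 by rewrite gt_eqF // Z_gt0.
(* Eliminating beta turns the relation between Z, beta and c into an identity
   of rational functions. *)
have hb : beta ^+ 2 = (Z ^+ 2 - c ^+ 2) / (1 - c ^+ 2).
  by rewrite /Z Zof_sq ZsqE; field.
rewrite hdF /dE hom hov /dr_omega hog hrom hW /dr_sq gamma_sq /r_omega hrom.
rewrite /r_sq gamma_sq e2 hU /dJsq /dA /dD /dZ hU /Jsq /Aof /Dof -/c -/Z hb.
have n0 : eta != 0 by rewrite gt_eqF.
by field; rewrite Z0 N0 n0.
Qed.

(** Tangent vectors along the fibres of the projection to [gamma]. *)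
Lemma tangent_fibre w : dot w (gamma_of z) = 0 ->
  (row_mx w 0 <= tangentM4 z)%MS.
Proof.
move=> h; apply/tangentE; rewrite row_mx_omega row_mx_gamma h !dotE !mxE.
by split; ring.
Qed.

Lemma mul_jacobian_Phi_fibre w :
  row_mx w 0 *m jacobian Phi z = vec2 (Num.sqrt (Jsq z) * w 0 2)
    ((w0 z * w 0 0 + w1 z * w 0 1 + nu * (w2 z * w 0 2)) / eta
     + r_sq z * (w0 z * w 0 0 + w1 z * w 0 1 + w2 z * w 0 2)
     - r_omega z * (Aof z * (g0 z * w 0 0 + g1 z * w 0 1) + Dof z * w 0 2)).
Proof.
have o3 (i : 'I_3) : (0 : 'rV[R]_3) 0 i = 0 by rewrite mxE.
rewrite mul_jacobian_Phi /dF2 /dE /dr_sq /dr_omega /dJsq /dA /dD /dZ.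
rewrite row_mx_omega row_mx_gamma !o3 !(mulr0, addr0, mul0r, oppr0, subr0).
by congr vec2; ring.
Qed.

Lemma inertia_r_sq_gt0 : 0 < 1 / eta + r_sq z.
Proof.
rewrite ltr_wpDr ?divr_gt0 // addr_ge0 ?sqr_ge0 // gamma_sq.
by rewrite mulr_ge0 ?sqr_ge0 // subr_ge0 c_sq_le1.
Qed.

Lemma sqrtJsq_gt0 : 0 < Num.sqrt (Jsq z).
Proof. by rewrite sqrtr_gt0 Jsq_gt0. Qed.

Section OffPoles.
Hypothesis c1 : c ^+ 2 != 1.

Let k := e3 R - c *: gamma_of z.

Lemma k_coord : (k 0 0 = - (c * g0 z)) * (k 0 1 = - (c * g1 z))
  * (k 0 2 = 1 - c ^+ 2).
Proof.
by rewrite /k /e3 /c; do !split; rewrite !mxE /=; ring.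
Qed.

Lemma dot_k_gamma : dot k (gamma_of z) = 0.
Proof.
rewrite dotE !k_coord -/c.
transitivity (c * (1 - c ^+ 2 - (g0 z ^+ 2 + g1 z ^+ 2))); first by ring.
by rewrite gamma_sq subrr mulr0.
Qed.

Lemma dot_k_k : dot k k = 1 - c ^+ 2.
Proof.
rewrite dotE !k_coord; transitivity (c ^+ 2 * (g0 z ^+ 2 + g1 z ^+ 2)
  + (1 - c ^+ 2) ^+ 2); first by ring.
by rewrite gamma_sq; ring.
Qed.

Lemma one_sub_c_sq_neq0 : 1 - c ^+ 2 != 0.
Proof. by rewrite subr_eq0 eq_sym. Qed.

(** Off the poles the rank is therefore at least 1: along [(k, 0)] only [p]
    varies, and [F2] with it. *)
Lemma mul_jacobian_Phi_k_neq0 : row_mx k 0 *m jacobian Phi z != 0.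
Proof.
rewrite mul_jacobian_Phi_fibre; apply/eqP => /rowP/(_ 0).
rewrite vec2E k_coord mxE => /eqP; apply/negP.
by rewrite mulf_neq0 ?one_sub_c_sq_neq0 // gt_eqF // sqrtJsq_gt0.
Qed.

Lemma rank_dPhi_meridional p : omega_of z = p *: k ->
  p ^+ 2 * Jsq z * c + (1 - beta ^+ 2) * c / Z + alpha = 0 ->
  rank_dPhi alpha beta nu eta z = 1%N.
Proof.
move=> om h0; pose u := vec2 1 (p * Num.sqrt (Jsq z)).
apply: (rank_mulmx_eq1 u (row_mx k 0)).
- move=> v vT; apply/sub_rVP; exists (dF2 z v).
  rewrite mul_jacobian_Phi (dE_meridional v p c1 om vT) h0 mul0r addr0.
  by apply/rowP => -[[|[|//]] i]; rewrite !mxE /= ?mulr1 // mulrC.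
- exact/tangent_fibre/dot_k_gamma.
exact: mul_jacobian_Phi_k_neq0.
Qed.

(** The tangent vector [(n, 0)], with [n = e3 x gamma], lies in the kernel of
    [dF2].  If the rank is 1 it must lie in the kernel of [dE] too, and
    there [dE = (1 / eta + |r|^2) (omega, n)].  Hence [omega], being
    orthogonal to [gamma] and to [n], is a multiple of [k]. *)
Lemma rank1_omega_meridional : rank_dPhi alpha beta nu eta z = 1%N ->
  omega_of z = (w2 z / (1 - c ^+ 2)) *: k.
Proof.
move=> rk; pose n := vec3 (- g1 z) (g0 z) 0.
have kT := submxMr (jacobian Phi z) (tangent_fibre k dot_k_gamma).
have nT : (row_mx n 0 <= tangentM4 z)%MS.
  by apply: tangent_fibre; rewrite dotE !vec3E; ring.
have := rank1_proportional rk kT (submxMr _ nT) mul_jacobian_Phi_k_neq0.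
rewrite !mul_jacobian_Phi_fibre => -[a E].
move: (E 0) (E 1); rewrite !vec2E /n !vec3E !k_coord !mulr0 => /esym/eqP.
rewrite mulf_eq0 mulf_eq0 (gt_eqF sqrtJsq_gt0) (negPf one_sub_c_sq_neq0) !orbF.
move=> /eqP->.
rewrite mul0r => En.
have {}En : (1 / eta + r_sq z) * (- (w0 z * g1 z) + w1 z * g0 z) = 0.
  by rewrite -En; ring.
have r0 := inertia_r_sq_gt0.
move/eqP: En; rewrite mulf_eq0 (gt_eqF r0) /= => /eqP On.
have /eqP := omega_gamma; rewrite addr_eq0 => /eqP Og.
apply: row3P; rewrite [RHS]mxE !k_coord.
- transitivity (w0 z * (1 - c ^+ 2) / (1 - c ^+ 2)).
    by rewrite mulfK ?one_sub_c_sq_neq0.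
  rewrite -gamma_sq.
  have -> : w0 z * (g0 z ^+ 2 + g1 z ^+ 2) =
    g0 z * (w0 z * g0 z + w1 z * g1 z)
    - g1 z * (- (w0 z * g1 z) + w1 z * g0 z) by ring.
  by rewrite On Og; ring.
- transitivity (w1 z * (1 - c ^+ 2) / (1 - c ^+ 2)).
    by rewrite mulfK ?one_sub_c_sq_neq0.
  rewrite -gamma_sq.
  have -> : w1 z * (g0 z ^+ 2 + g1 z ^+ 2) =
    g1 z * (w0 z * g0 z + w1 z * g1 z)
    + g0 z * (- (w0 z * g1 z) + w1 z * g0 z) by ring.
  by rewrite On Og; ring.
by rewrite mulfVK ?one_sub_c_sq_neq0.
Qed.

(** By [dE_meridional], [dE - p J dF2] vanishes on [(k, 0)].  When the rank is
    1 it then vanishes on the tangent vector [(- p |k|^2 gamma, k)] as well,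
    along which [gamma_3] has the derivative [|k|^2], which is not 0. *)
Lemma rank1_equilibrium p : omega_of z = p *: k ->
  rank_dPhi alpha beta nu eta z = 1%N ->
  p ^+ 2 * Jsq z * c + (1 - beta ^+ 2) * c / Z + alpha = 0.
Proof.
move=> om rk.
have kT := tangent_fibre k dot_k_gamma.
pose v := row_mx (- (p * (1 - c ^+ 2)) *: gamma_of z) k.
have vT : (v <= tangentM4 z)%MS.
  apply/tangentE; rewrite row_mx_omega row_mx_gamma om !dotZl dot_k_k.
  by rewrite -/(F0 z) M4z.1 dotC dot_k_gamma; split=> //; ring.
have := rank1_proportional rk (submxMr _ kT) (submxMr _ vT)
  mul_jacobian_Phi_k_neq0.
rewrite !mul_jacobian_Phi => -[a E]; move: (E 0) (E 1); rewrite !vec2E.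
rewrite (dE_meridional _ p c1 om vT) (dE_meridional _ p c1 om kT) => ->.
rewrite !row_mx_gamma k_coord [(0 : 'rV_3) _ _]mxE mulr0 addr0 => /eqP.
rewrite mulrCA -subr_eq0 [X in X - _]addrC addrK mulf_eq0.
by rewrite (negPf one_sub_c_sq_neq0) orbF => /eqP.
Qed.

End OffPoles.

(** At a pole [r] is parallel to [gamma] and [omega] is horizontal.  If
    [omega = 0], then [w2 v = g2 v = 0] for every tangent [v] and the rank is
    0.  Otherwise it is 2: [dF2] vanishes on [(omega, 0)] while [dE] does not,
    and [dF2] does not vanish on the tangent vector
    [(- gamma_3 |omega|^2 e3, omega)]. *)
Lemma rank_dPhi_pole : c ^+ 2 = 1 -> rank_dPhi alpha beta nu eta z <> 1%N.
Proof.
move=> c1; have := gamma_sq; rewrite c1 subrr => /eqP.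
rewrite paddr_eq0 ?sqr_ge0 // !sqrf_eq0 => /andP[/eqP x0 /eqP y0].
have c0 : c != 0 by rewrite -sqrf_eq0 c1 oner_neq0.
have := omega_gamma; rewrite x0 y0 !mulr0 !add0r => /eqP.
rewrite mulf_eq0 (negPf c0) orbF => /eqP o2.
pose n2 := w0 z ^+ 2 + w1 z ^+ 2.
have [on|on] := eqVneq n2 0.
  move/eqP: on; rewrite paddr_eq0 ?sqr_ge0 // !sqrf_eq0.
  move=> /andP[/eqP o0 /eqP o1].
  move=> rk.
  suff : \rank (tangentM4 z *m jacobian Phi z) == 0%N.
    by rewrite -[\rank _]/(rank_dPhi alpha beta nu eta z) rk.
  rewrite mxrank_eq0 -submx0; apply/row_subP => i.
  rewrite row_mul; set v := row i _.
  have /tangentE[] : (v <= tangentM4 z)%MS by exact: row_sub.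
  rewrite !dotE x0 y0 o0 o1 o2 !(mul0r, mulr0, add0r, addr0) => /eqP.
  rewrite mulf_eq0 (negPf c0) /= => /eqP v3 /eqP.
  rewrite mulf_eq0 (negPf c0) orbF => /eqP u3.
  rewrite submx0 mul_jacobian_Phi /dF2 /dE /dZ /r_omega /dr_omega.
  rewrite x0 y0 o0 o1 o2 v3 u3; apply/eqP.
  by apply/rowP => -[[|[|//]] j]; rewrite !mxE /=; ring.
move=> rk.
have uT : (row_mx (omega_of z) 0 <= tangentM4 z)%MS.
  exact/tangent_fibre/M4z.2.
pose v := row_mx (- (c * n2) *: e3 R) (omega_of z).
have vT : (v <= tangentM4 z)%MS.
  apply/tangentE; rewrite row_mx_omega row_mx_gamma dotC.
  split; first exact: M4z.2.
  rewrite dotZl !dotE /e3 !vec3E o2 -/c.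
  transitivity (n2 * (1 - c ^+ 2)); first by rewrite /n2; ring.
  by rewrite c1 subrr mulr0.
have r0 := inertia_r_sq_gt0.
have uE : row_mx (omega_of z) 0 *m jacobian Phi z
    = vec2 0 ((1 / eta + r_sq z) * n2).
  rewrite mul_jacobian_Phi_fibre /r_omega x0 y0 o2 /n2.
  by congr vec2; ring.
have := rank1_proportional rk (submxMr _ uT) (submxMr _ vT).
rewrite uE => -[|a /(_ 0)].
  apply/eqP => /rowP/(_ 1)/eqP; rewrite vec2E mxE.
  by rewrite mulf_eq0 (gt_eqF r0) (negPf on).
rewrite mul_jacobian_Phi !vec2E mulr0 /dF2 o2 mul0r addr0 row_mx_omega mxE.
rewrite /e3 vec3E mulr1 => /eqP; rewrite mulf_eq0 oppr_eq0 mulf_eq0.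
by rewrite (gt_eqF sqrtJsq_gt0) (negPf c0) (negPf on).
Qed.

Lemma rank_dPhi1P : rank_dPhi alpha beta nu eta z = 1%N <->
  c ^+ 2 != 1 /\ exists2 p, omega_of z = p *: (e3 R - c *: gamma_of z)
    & p ^+ 2 * Jsq z * c + (1 - beta ^+ 2) * c / Z + alpha = 0.
Proof.
split=> [rk|[c1 [p om h]]]; last exact: (rank_dPhi_meridional c1 p).
have c1 : c ^+ 2 != 1 by apply/eqP => /rank_dPhi_pole.
split=> //; have om := rank1_omega_meridional c1 rk.
by eexists; [exact: om|exact: (rank1_equilibrium c1)].
Qed.

End AtPoint.

(** * From the equilibrium condition to the angular velocity *)

(** The difference of the two sides of the first equation is the left side of
    the second one times [sin^2 theta / (J^2 cos theta)]. *)
Lemma omega0_sqP z theta (w : R) : M4 z -> cos theta = g2 z ->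
    0 < sin theta -> g2 z != 0 ->
  w ^+ 2 = omega0_sq alpha beta nu eta theta <->
  (w / sin theta) ^+ 2 * Jsq z * g2 z + (1 - beta ^+ 2) * g2 z / Zof z + alpha
    = 0.
Proof.
move=> zM ct s0 c0.
have s2 : sin theta ^+ 2 = 1 - g2 z ^+ 2.
  by rewrite -ct -(cos2Dsin2 theta) [X in _ = X - _]addrC addrK.
have Zt : Zfun beta theta = Zof z.
  by rewrite /Zof (ZsqE _ zM) /Zfun s2 ct.
have Z0 : Zof z != 0 by rewrite gt_eqF // Z_gt0.
have Q0 : Jsq z != 0 by rewrite gt_eqF // Jsq_gt0.
have n0 : eta != 0 by rewrite gt_eqF.
have sn0 : sin theta != 0 by rewrite gt_eqF.
have E : w ^+ 2 - omega0_sq alpha beta nu eta theta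
    = sin theta ^+ 2 / (Jsq z * g2 z) * ((w / sin theta) ^+ 2 * Jsq z * g2 z
        + (1 - beta ^+ 2) * g2 z / Zof z + alpha).
  have etaQ : eta * (Zof z + alpha * g2 z) ^+ 2 + g2 z ^+ 2
      + nu * sin theta ^+ 2 = eta * Jsq z by rewrite s2 /Jsq; field.
  rewrite /omega0_sq Zt ct etaQ; field.
  by rewrite c0 Q0 Z0 n0 sn0.
split=> [h|h]; last by apply/eqP; rewrite -subr_eq0 E h mulr0.
move/eqP: E; rewrite h subrr eq_sym !mulf_eq0 invr_eq0 mulf_eq0.
by rewrite (negPf sn0) (negPf Q0) (negPf c0) /= => /eqP.
Qed.

End IntegralMap.

Theorem mainTheorem1 (R : realType) (alpha beta nu eta : R)
    (halpha : 0 < alpha <= 1) (hbeta : 0 < beta)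
    (hnu : 0 < nu <= 2) (heta : 0 < eta) :
  S1 alpha beta nu eta = S1alpha alpha beta nu eta.
Proof.
case/andP: hnu => hnu _; case/andP: halpha => halpha _.
have rankP := rank_dPhi1P alpha _ _ _ hbeta hnu heta.
have omegaP := omega0_sqP alpha _ _ _ hbeta hnu heta.
apply/seteqP; split=> z /=.
  move=> [zM /(rankP z zM)[c1 [p om h]]].
  set c := gamma_of z 0 2 in c1 om h.
  have zM' : dot (gamma_of z) (gamma_of z) = 1 by exact: zM.1.
  have xy := gamma_sq z zM; rewrite -/c in xy.
  have c_lt1 : c ^+ 2 < 1 by rewrite lt_neqAle c1 c_sq_le1.
  have hc : -1 < c < 1 by move: c_lt1; clear; move=> ?; apply/andP; split; nra.
  (* On the equator the equilibrium condition reduces to alpha = 0. *)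
  have c0 : c != 0.
    apply: contraTneq halpha => c0; rewrite -leNgt.
    by move: h; rewrite c0 !mulr0 mul0r !add0r => ->.
  have /andP[cm1 cp1] := hc.
  have ci : c \in `[-1, 1] by rewrite in_itv /= !ltW.
  pose s := Num.sqrt (1 - c ^+ 2).
  have s0 : 0 < s by rewrite sqrtr_gt0 subr_gt0.
  have s2 : s ^+ 2 = 1 - c ^+ 2 by rewrite sqr_sqrtr // subr_ge0 ltW.
  have ct : cos (acos c) = c by exact: acosK.
  have st : sin (acos c) = s by rewrite sin_acos // !ltW.
  have := polar_angle (gamma_of z 0 0 / s) (gamma_of z 0 1 / s).
  rewrite !expr_div_n -mulrDl xy s2 divff ?subr_eq0 1?eq_sym // => /(_ erefl).
  move=> [phi hphi [ex ey]].
  have w2 : (p * s) ^+ 2 = omega0_sq alpha beta nu eta (acos c).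
    by apply/(omegaP z); rewrite ?ct ?st ?mulfK // gt_eqF.
  exists (acos c), phi, (p * s); split=> //.
  - rewrite acos_gt0 ?acos_ltpi ?cm1 ?cp1 ?(ltW cm1) ?(ltW cp1) //.
    split=> // e; move: c0; rewrite -ct e cos_pihalf eqxx //.
  - by rewrite -w2 sqr_ge0.
  - apply: row3P; rewrite /gamma_angles vec3E ?ct // st.
      by rewrite -ex mulrC divfK // gt_eqF.
    by rewrite -ey mulrC divfK // gt_eqF.
  rewrite cross_cross_e3 // enorm_cross_e3 // -/c -/s scalerA mulfK ?gt_eqF //.
move=> [theta [phi [w [[th th2] hphi [_ w2] hg ho]]]].
have s0 : 0 < sin theta by exact: sin_gt0_pi.
have gg : dot (gamma_of z) (gamma_of z) = 1.
  rewrite hg /gamma_angles dotE !vec3E.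
  transitivity (sin theta ^+ 2 * (cos phi ^+ 2 + sin phi ^+ 2) + cos theta ^+ 2).
    by ring.
  by rewrite cos2Dsin2 mulr1 addrC cos2Dsin2.
have g2 : gamma_of z 0 2 = cos theta by rewrite hg /gamma_angles vec3E.
have s2 : 1 - cos theta ^+ 2 = sin theta ^+ 2.
  by rewrite -(cos2Dsin2 theta) [X in X - _]addrC addrK.
have om : omega_of z = (w / sin theta) *: (e3 R - gamma_of z 0 2 *: gamma_of z).
  rewrite ho cross_cross_e3 // enorm_cross_e3 // g2 s2 sqrtr_sqr scalerA.
  by rewrite gtr0_norm.
have zM : M4 z.
  split; first exact: gg.
  rewrite /F1 om dotZl.
  rewrite (_ : dot _ _ = gamma_of z 0 2 * (1 - dot (gamma_of z) (gamma_of z))).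
    by rewrite gg subrr !mulr0.
  by rewrite !dotE /e3 !mxE /=; ring.
have c0 : cos theta != 0.
  apply/eqP => c0; apply: th2; apply: cos_inj; last by rewrite c0 cos_pihalf.
    by case/andP: th => *; rewrite in_itv /= !ltW.
  by have := pi_gt0 R; rewrite in_itv /= => ?; apply/andP; split; lra.
split=> //; apply/(rankP z zM); split.
  rewrite g2 -subr_eq0 -oppr_eq0 opprB s2 sqrf_eq0 gt_eqF //.
by exists (w / sin theta) => //; apply/(omegaP z theta); rewrite ?g2.
Qed.
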